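(* Let $|\psi_{id}\rangle\in\mathbb{C}^d$ be a unit vector and let $\rho$ be a density matrix on $\mathbb{C}^d$ with eigenvalues $\lambda>\lambda_2\ge\dots\ge\lambda_d\ge0$ and corresponding orthonormal eigenvectors $|\psi\rangle,|\psi_2\rangle,\dots,|\psi_d\rangle$, and let $\lambda_m$ be the smallest non-zero eigenvalue of $\rho$. Let $c=1-|\langle\psi_{id}|\psi\rangle|^2$, let $\sigma\ge0$ be given by $\sigma^2=\langle\psi_{id}|\rho^2|\psi_{id}\rangle-\langle\psi_{id}|\rho|\psi_{id}\rangle^2$, and define $\Delta_{\mathrm m}=\sigma_r/(1-Q_{\mathrm m})$, which depends only on two parameters: the relative commutator norm $\sigma_r=\sigma/\lambda$ and the ratio $Q_{\mathrm m}=\lambda_m/\lambda$. Then the coherent mismatch satisfies $$c\ge\frac{1-\sqrt{1-4\Delta_{\mathrm m}^2}}{2}=\Delta_{\mathrm m}^2+\Delta_{\mathrm m}^4+\mathcal{O}(\Delta_{\mathrm m}^6),$$ and for any fixed $\Delta_{\mathrm m}$ there exist an infinite number of best-case states $\rho$ that saturate this lower bound. The dominant eigenvector $|\psi\rangle$ of the extremal state $\rho$ and its eigenvector $|\psi_m\rangle$ that corresponds to the smallest non-zero eigenvalue $\lambda_m$ have non-zero overlaps with $|\psi_{id}\rangle$. All other eigenvectors $|\psi_k\rangle$ of $\rho$, with $k\in\{2,3,\dots,m-1,m+1,\dots,d\}$, are orthogonal to $|\psi_{id}\rangle$.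
   Context: A density matrix is a positive semidefinite complex matrix of trace one. The quantity $c$ is called the coherent mismatch; it is the infidelity between the dominant eigenvector $|\psi\rangle$ of $\rho$ and the ideal state $|\psi_{id}\rangle$. With $\rho_{id}=|\psi_{id}\rangle\langle\psi_{id}|$, the number $\sigma$ equals the operator norm of the commutator $[\rho_{id},\rho]$ (the commutator norm).
   Formalization: Assumes the ideal state is orthogonal to the kernel of ρ (the bound fails otherwise); non-zero overlap with ψ_m only for Δ_m>0; for degenerate λ_m its eigenvectors are suitably chosen; saturating states for 0≤Δ_m≤1/2 and d≥2. *)

(* Defs.v *)
From HB Require Import structures.
From mathcomp Require Export all_boot all_order all_algebra.
From mathcomp Require Export complex.
From mathcomp Require Export all_classical all_reals all_analysis.

Set Implicit Arguments.
Unset Strict Implicit.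
Unset Printing Implicit Defensive.

Import Order.TTheory GRing.Theory Num.Theory.
Import numFieldNormedType.Exports.

Local Open Scope ring_scope.
Local Open Scope complex_scope.
Local Open Scope sesquilinear_scope.

Section Quantum.
Variables (R : realType) (d : nat).
Implicit Types (u v psi : 'cV[R[i]]_d) (rho : 'M[R[i]]_d).

(* Kets are column vectors; the bracket is antilinear in the first argument. *)
Definition braket u v : R[i] := (u^t* *m v) 0 0.

(* The order of R[i] is partial: 0 <= z says that z is real and nonnegative. *)
Definition density rho : Prop :=
  [/\ rho \is hermsymmx,
      forall u, 0 <= braket u (rho *m u)
    & \tr rho = 1].

Definition infidelity u v : R := 1 - complex.Re `|braket u v| ^+ 2.

(* For rho Hermitian, the expectation values are real, so that Re merely casts
   them to R, and the radicand is nonnegative by Cauchy-Schwarz. *)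
Definition std_dev rho psi : R :=
  Num.sqrt (complex.Re (braket psi (rho *m rho *m psi))
            - complex.Re (braket psi (rho *m psi)) ^+ 2).

(* psi lies in the support of rho.  A component of psi in the kernel of rho
   raises std_dev beyond what the smallest nonzero eigenvalue controls: the
   lower bound on the infidelity fails for rho = diag(9/10, 1/10, 0) and
   psi = (sqrt (9/10), 0, sqrt (1/10)). *)
Definition no_kernel_overlap rho psi : Prop :=
  forall u, rho *m u = 0 -> braket u psi = 0.

End Quantum.

Section Spectrum.
Variables (R : realType) (n : nat).
Implicit Types (rho : 'M[R[i]]_n.+1) (lam : 'I_n.+1 -> R)
  (v : 'I_n.+1 -> 'cV[R[i]]_n.+1) (m : 'I_n.+1).

(* An orthonormal eigenbasis with the eigenvalues in nonincreasing order; the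
   index ord0 carries the dominant, nondegenerate eigenvalue. *)
Definition eigensystem rho lam v : Prop :=
  [/\ forall j k, braket (v j) (v k) = (j == k)%:R,
      forall k, rho *m v k = (lam k)%:C *: v k,
      forall k, k != ord0 -> lam k < lam ord0,
      forall j k : 'I_n.+1, (j <= k)%N -> lam k <= lam j
    & forall k, 0 <= lam k].

Definition smallest_nonzero lam m : Prop :=
  lam m != 0 /\ forall k, lam k != 0 -> lam m <= lam k.

(* Meaningful only if lam m < lam ord0; the totalized division gives 0 when
   lam m = lam ord0, i.e. when rho is pure. *)
Definition Delta_m rho (psi_id : 'cV[R[i]]_n.+1) lam m : R :=
  (std_dev rho psi_id / lam ord0) / (1 - lam m / lam ord0).

End Spectrum.

Definition mismatch_bound (R : realType) (x : R) : R :=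
  (1 - Num.sqrt (1 - 4 * x ^+ 2)) / 2.

(* Main.v *)
(* Write p_k = |<v_k|psi_id>|^2, rescale the spectrum to the numbers
   y_k = (lam_0 - lam_k) / (lam_0 - lam_m), which lie in [0, 1] on the support
   of p, and let t be the p-mean of y. As y_0 = 0, t <= 1 - p_0 = c, while
   Delta_m^2 is the variance of y, so that Delta_m^2 <= t (1 - t); the function
   inverting x (1 - x) on [0, 1/2] gives the bound. Equality forces t = c, i.e.
   p_k = 0 unless lam_k is lam_0 or lam_m, and a reflection acting inside the
   lam_m-eigenspace collects what is left of psi_id in one eigenvector.
   States of rank two with eigenvalues a > 1 - a > 0, whose eigenvectors are
   psi_id and an orthogonal vector rotated by an angle fixed by D,
   saturate the bound for every a. *)

Require Import Defs.
From mathcomp Require Import ring lra.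

Set Implicit Arguments.
Unset Strict Implicit.
Unset Printing Implicit Defensive.
Import Order.TTheory GRing.Theory Num.Theory.
Import numFieldNormedType.Exports.
Local Open Scope classical_set_scope.
Local Open Scope ring_scope.
Local Open Scope complex_scope.
Local Open Scope sesquilinear_scope.

(** * Sesquilinear algebra of the bracket *)

Section Braket.
Variables (R : realType) (d : nat).
Implicit Types (u v w : 'cV[R[i]]_d) (A : 'M[R[i]]_d) (a : R[i]).

Lemma braketC u v : braket v u = (braket u v)^*%R.
Proof.
rewrite /braket !mxE rmorph_sum; apply: eq_bigr => j _ /=.
by rewrite !mxE rmorphM /= conjCK mulrC.
Qed.

Lemma braketDr u v w : braket u (v + w) = braket u v + braket u w.
Proof. by rewrite /braket mulmxDr mxE. Qed.

Lemma braketZr u a v : braket u (a *: v) = a * braket u v.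
Proof. by rewrite /braket -scalemxAr mxE. Qed.

Lemma braketBr u v w : braket u (v - w) = braket u v - braket u w.
Proof. by rewrite -scaleN1r braketDr braketZr mulN1r. Qed.

Lemma braket0r u : braket u 0 = 0.
Proof. by rewrite -(scale0r 0) braketZr mul0r. Qed.

Lemma braketDl u v w : braket (u + v) w = braket u w + braket v w.
Proof. by rewrite braketC braketDr rmorphD /= -!braketC. Qed.

Lemma braketZl a u v : braket (a *: u) v = a^*%R * braket u v.
Proof. by rewrite braketC braketZr rmorphM /= -!braketC. Qed.

Lemma braketBl u v w : braket (u - v) w = braket u w - braket v w.
Proof. by rewrite braketC braketBr rmorphB /= -!braketC. Qed.

Lemma braket_sumr (I : finType) u (f : I -> 'cV_d) :
  braket u (\sum_i f i) = \sum_i braket u (f i).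
Proof. by rewrite /braket mulmx_sumr summxE. Qed.

Lemma braket_mulmxr A u v : braket u (A *m v) = braket (A^t* *m u) v.
Proof. by rewrite /braket mulmxA trmx_mul map_mxM trmxCK. Qed.

Lemma braket_adj A u v : A \is hermsymmx -> braket u (A *m v) = braket (A *m u) v.
Proof. by move=> /is_hermitianmxP; rewrite expr0 scale1r => {2}->; rewrite braket_mulmxr. Qed.

Lemma braketuu u : braket u u = \sum_i `|u i 0| ^+ 2.
Proof.
rewrite /braket mxE; apply: eq_bigr => j _.
by rewrite !mxE mulrC -normCK.
Qed.

Lemma braketuu_eq0 u : (braket u u == 0) = (u == 0).
Proof.
apply/idP/eqP => [|->]; last by rewrite braket0r.
rewrite braketuu psumr_eq0 => [/allP u0|i _]; last by rewrite exprn_ge0.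
apply/colP => i; rewrite mxE; apply/eqP.
by have := u0 i; rewrite mem_index_enum /= sqrf_eq0 normr_eq0 => ->.
Qed.
End Braket.

(** * Orthonormal bases, Parseval's identity and moments of the spectrum *)

Definition orthonormal_basis (R : realType) d (v : 'I_d -> 'cV[R[i]]_d) : Prop :=
  forall j k, braket (v j) (v k) = (j == k)%:R.

(** The Born probability of outcome [k]. The modulus is already real, so [complex.Re] is only a
    cast. *)
Definition weight (R : realType) d (v : 'I_d -> 'cV[R[i]]_d) psi (k : 'I_d) : R :=
  complex.Re `|braket (v k) psi| ^+ 2.

Definition col_frame (R : realType) d (v : 'I_d -> 'cV[R[i]]_d) : 'M[R[i]]_d :=
  \matrix_(i, k) v k i 0.

Section Basis.
Variables (R : realType) (d : nat) (v : 'I_d -> 'cV[R[i]]_d).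
Hypothesis von : orthonormal_basis v.
Implicit Types (x y psi : 'cV[R[i]]_d) (rho : 'M[R[i]]_d).

Lemma col_frameKV : (col_frame v)^t* *m col_frame v = 1%:M.
Proof.
apply/matrixP => j k; rewrite !mxE -von /braket mxE.
by apply: eq_bigr => i _; rewrite !mxE.
Qed.

(** A left inverse of a square matrix is a right inverse: [d] orthonormal vectors are complete,
    which yields the expansion below. *)
Lemma col_frameVK : col_frame v *m (col_frame v)^t* = 1%:M.
Proof. exact/mulmx1C/col_frameKV. Qed.

Lemma basis_expand x : x = \sum_k braket (v k) x *: v k.
Proof.
rewrite -{1}[x]mul1mx -col_frameVK -mulmxA; apply/colP => i.
rewrite mxE summxE; apply: eq_bigr => k _; rewrite !mxE mulrC /braket !mxE.
by congr (_ * _); apply: eq_bigr => j _; rewrite !mxE.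
Qed.

Lemma parseval x y : braket x y = \sum_k braket x (v k) * braket (v k) y.
Proof.
rewrite {1}(basis_expand y) braket_sumr; apply: eq_bigr => k _.
by rewrite braketZr mulrC.
Qed.

Lemma weightE psi k : (weight v psi k)%:C = `|braket (v k) psi| ^+ 2.
Proof. by rewrite /weight rmorphXn; congr (_ ^+ 2); apply/RRe_real/normr_real. Qed.

Lemma weight_ge0 psi k : 0 <= weight v psi k.
Proof. exact: sqr_ge0. Qed.

Lemma weight_eq0 psi k : (weight v psi k == 0) = (braket (v k) psi == 0).
Proof.
rewrite -[RHS]normr_eq0 -[RHS](sqrf_eq0 `|_|) -weightE.
by rewrite -(inj_eq (@complexI R)).
Qed.

Lemma sum_weight psi : braket psi psi = 1 -> \sum_k weight v psi k = 1.
Proof.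
move=> psi1; apply: (@complexI R); rewrite rmorph_sum rmorph1 -psi1 parseval.
apply: eq_bigr => k _; rewrite [LHS]weightE.
by rewrite normCK mulrC -braketC.
Qed.

Section Moments.
Variables (rho : 'M[R[i]]_d) (lam : 'I_d -> R).
Hypothesis rhov : forall k, rho *m v k = (lam k)%:C *: v k.

Lemma eigen_expect psi :
  complex.Re (braket psi (rho *m psi)) = \sum_k weight v psi k * lam k.
Proof.
rewrite {2}(basis_expand psi) mulmx_sumr braket_sumr raddf_sum.
apply: eq_bigr => k _; rewrite -scalemxAr rhov !braketZr mulrCA.
rewrite [braket psi _]braketC -normCK -weightE -rmorphM /=.
by rewrite mulrC.
Qed.

Lemma eigen_adj k x : rho \is hermsymmx ->
  braket (v k) (rho *m x) = (lam k)%:C * braket (v k) x.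
Proof.
move=> rhoH; rewrite braket_adj// rhov braketZl; congr (_ * _).
exact: conjc_real.
Qed.

End Moments.

(** The square of [rho] has the same eigenvectors with squared eigenvalues, so quantum uncertainty
    becomes the standard deviation of [lam] under the weights. *)
Lemma eigen_var rho lam psi : (forall k, rho *m v k = (lam k)%:C *: v k) ->
  std_dev rho psi = Num.sqrt (\sum_k weight v psi k * lam k ^+ 2
     - (\sum_k weight v psi k * lam k) ^+ 2).
Proof.
move=> rhov; rewrite /std_dev (eigen_expect rhov) (@eigen_expect _ (fun k => lam k ^+ 2))//.
by move=> k; rewrite -mulmxA rhov -scalemxAr rhov scalerA -rmorphM.
Qed.

End Basis.

(** * Householder reflections *)

Lemma conjCM (C : numClosedFieldType) (a b : C) : (a * b)^*%R = a^*%R * b^*%R.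
Proof. exact: rmorphM. Qed.

Lemma conjCV (C : numClosedFieldType) (a : C) : (a^-1)^*%R = (a^*%R)^-1.
Proof. exact: fmorphV. Qed.

Section Reflection.
Variables (R : realType) (d : nat).
Implicit Types (u x y q : 'cV[R[i]]_d).

(** At [u = 0] this is the identity, so degenerate cases stay within the same formula. *)
Definition reflection u x := x - (2 * braket u x / braket u u) *: u.

Lemma conj_reflection_coef u x :
  (2 * braket u x / braket u u)^*%R = 2 * braket x u / braket u u.
Proof. by rewrite !conjCM conjCV conjC_nat -!braketC. Qed.

Lemma reflection_self_adjoint u x y :
  braket (reflection u x) y = braket x (reflection u y).
Proof.
rewrite braketBl braketBr braketZl braketZr conj_reflection_coef.
by congr (_ - _); ring.
Qed.

Lemma reflectionK u : involutive (reflection u).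
Proof.
move=> x; have [->|u0] := eqVneq u 0; first by rewrite /reflection !scaler0 !subr0.
rewrite {1}/reflection [braket u (reflection _ _)]braketBr braketZr -braketuu_eq0 in u0 *.
rewrite /reflection -addrA -opprD -scalerDl.
(* The first reflection changes the sign of the bracket with [u], so the two coefficients of [u]
   cancel. *)
rewrite [X in X *: _](_ : _ = 0) ?scale0r ?subr0//.
by field.
Qed.

Lemma reflection_fix u x : braket u x = 0 -> reflection u x = x.
Proof. by move=> ux; rewrite /reflection ux mulr0 mul0r scale0r subr0. Qed.

(** A self-adjoint involution is unitary. *)
Lemma reflection_onb u (v : 'I_d -> 'cV[R[i]]_d) :
  orthonormal_basis v -> orthonormal_basis (reflection u \o v).
Proof. by move=> von j k /=; rewrite reflection_self_adjoint reflectionK. Qed.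

(* The phase of a makes <a e, q> real, without which no reflection
   would swap a e and q over the complex numbers. *)
Lemma reflection_to_axis e q : braket e e = 1 ->
  exists a : R[i], reflection (a *: e - q) q = a *: e.
Proof.
move=> e1; set b := braket e q; set s := sqrtC (braket q q).
have ss : s * s = braket q q by rewrite -expr2 sqrtCK.
have qq_ge0 : 0 <= braket q q by rewrite braketuu sumr_ge0// => i _; rewrite exprn_ge0.
have sC : (s)^*%R = s by apply/CrealP/ger0_real; rewrite sqrtC_ge0.
(* [p] is the phase of [b], or 1 if [b = 0]; the second equation says that the bracket of [p *: e]
   with [q] is real. *)
have [p pp pb] : exists2 p : R[i], (p)^*%R * p = 1 & (p)^*%R * b = p * (b)^*%R.
  have [b0|b0] := eqVneq b 0.
    by exists 1; rewrite ?b0 rmorph1 ?conjC0 ?mulr1 ?mulr0.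
  exists (b / `|b|).
    by rewrite mulrC -normCK normrM normfV normr_id divff ?normr_eq0// expr1n.
  by rewrite conjCM conjCV conj_normC; ring.
exists (s * p); set u := _ - q.
(* Holds since [(s * p) *: e] and [q] have equal norms and a real bracket. The coefficient in the
   reflection is then -1, so [q] goes to [q + u], the wanted multiple of [e]. *)
have uuq : braket u u = - (2 * braket u q).
  rewrite /u !braketBl !braketBr !braketZl !braketZr e1 -/b (braketC e q) -/b.
  rewrite conjCM sC -ss.
  apply/eqP; rewrite -subr_eq0; apply/eqP.
  transitivity (s * s * (p^*%R * p - 1) + s * (p^*%R * b - p * b^*%R)).
    by ring.
  by rewrite pp pb !subrr !mulr0 addr0.
rewrite /reflection; have [u0|u0] := eqVneq u 0.
  by rewrite u0 scaler0 subr0; apply/esym/eqP; rewrite -subr_eq0 -/u u0.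
have uq0 : 2 * braket u q != 0.
  by apply: contraNneq u0 => uq0; rewrite -braketuu_eq0 uuq uq0 oppr0.
by rewrite uuq invrN mulrN divff// scaleN1r opprK addrC subrK.
Qed.

End Reflection.

(** * The bound as a real function *)

Section MismatchBound.
Variable R : realType.
Implicit Types c t D : R.

Lemma mismatch_bound_ge0 D : 0 <= mismatch_bound D.
Proof.
have : Num.sqrt (1 - 4 * D ^+ 2) <= Num.sqrt 1 by rewrite ler_sqrt// gerBl mulr_ge0// sqr_ge0.
by rewrite sqrtr1 /mismatch_bound => ?; lra.
Qed.

Lemma mismatch_bound_le_half D : mismatch_bound D <= 1 / 2.
Proof. by rewrite /mismatch_bound; have := sqrtr_ge0 (1 - 4 * D ^+ 2); lra. Qed.

(** The bound is the smaller root of x (1 - x) = D^2; later arguments use this equation instead of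
    the square root. *)
Lemma mismatch_boundM D : 4 * D ^+ 2 <= 1 ->
  mismatch_bound D * (1 - mismatch_bound D) = D ^+ 2.
Proof.
move=> D1; rewrite /mismatch_bound.
have := @sqr_sqrtr R (1 - 4 * D ^+ 2); rewrite subr_ge0 => /(_ D1).
set s := Num.sqrt _ => s2; transitivity ((1 - s ^+ 2) / 4); first by field.
by rewrite s2; field.
Qed.

Lemma four_sqr_le1 D t : D ^+ 2 <= t * (1 - t) -> 4 * D ^+ 2 <= 1.
Proof. by move=> Dt; have := sqr_ge0 (t - 1 / 2); rewrite expr2; lra. Qed.

(** By monotonicity of x (1 - x) on [0, 1/2]: were [c] below the bound b, then t <= c < b <= 1/2
    would give t (1 - t) < b (1 - b) = D^2. *)
Lemma mismatch_bound_le D c t :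
  0 <= t <= c -> D ^+ 2 <= t * (1 - t) -> mismatch_bound D <= c.
Proof.
move=> /andP[t0 tc] Dt; have [c2|c2] := leP (1 / 2) c.
  exact: le_trans (mismatch_bound_le_half D) _.
have D1 := four_sqr_le1 Dt.
have := mismatch_boundM D1; have := mismatch_bound_le_half D.
set b := mismatch_bound D => b2 bb; rewrite leNgt; apply/negP => cb; nra.
Qed.

Lemma mismatch_bound_eq D t :
  0 <= t <= mismatch_bound D -> D ^+ 2 <= t * (1 - t) -> t = mismatch_bound D.
Proof.
move=> /andP[t0 tc] Dt.
have D1 := four_sqr_le1 Dt.
have := mismatch_boundM D1; have := mismatch_bound_le_half D.
move: tc; set b := mismatch_bound D => tb b2 bb.
by apply/eqP; rewrite eq_le tb leNgt; apply/negP => ?; nra.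
Qed.

(** With y = x^2 the root equation reads b - y = b^2, so the remainder b - y - y^2 = b^2 - y^2
    equals b^2 (b + y) exactly. As b <= 1/2 gives b <= 2 y, it is at most (2 y)^2 (3 y) = 12 y^3,
    whence the constant 12. *)
Lemma mismatch_bound_expansion :
  @mismatch_bound R =
    (fun x : R => x ^+ 2 + x ^+ 4) +O_ (0 : R) (fun x : R => x ^+ 6).
Proof.
apply/eqaddOP; near=> k; near=> x.
have x4 : `|x| < 1 / 4 by near: x; apply: (@nbhs0_lt R R^o (1 / 4)); lra.
have [x1 x2] : - (1/4) < x /\ x < 1/4 by move: x4; rewrite ltr_norml => /andP[].
have D1 : 4 * x ^+ 2 <= 1 by nra.
have bb := mismatch_boundM D1; have b2 := mismatch_bound_le_half x.
have b0 := mismatch_bound_ge0 x.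
have k12 : 12 <= k by near: k; apply: nbhs_pinfty_ge; rewrite num_real.
rewrite [X in `|X|](_ : _ = mismatch_bound x - (x ^+ 2 + x ^+ 4))//.
rewrite [leRHS](_ : _ = k * (x ^+ 2) ^+ 3); last first.
  by rewrite -exprM ger0_norm// (exprM x 2 3) exprn_ge0// sqr_ge0.
rewrite (_ : x ^+ 4 = (x ^+ 2) ^+ 2); last by rewrite -exprM.
move: bb b2 b0; set b := mismatch_bound x; set y := x ^+ 2 => bb b2 b0.
have by2 : b <= 2 * y by nra.
have y0 : 0 <= y by exact: sqr_ge0.
have -> : b - (y + y ^+ 2) = b ^+ 2 * (b + y) by rewrite -bb; ring.
rewrite ger0_norm; last by rewrite mulr_ge0 ?sqr_ge0// addr_ge0.
have yk : 12 * y ^+ 3 <= k * y ^+ 3 by rewrite ler_wpM2r// exprn_ge0.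
apply: le_trans yk.
have -> : 12 * y ^+ 3 = (2 * y) ^+ 2 * (3 * y) by ring.
by apply: ler_pM; rewrite ?sqr_ge0 ?addr_ge0// ?lerXn2r ?nnegrE//; lra.
Unshelve. all: by end_near. Qed.

End MismatchBound.

(** * Variance of a rescaled spectrum *)

Section Variance.
Variables (R : realType) (n : nat) (p lam : 'I_n.+1 -> R) (m : 'I_n.+1).
Hypotheses (p_ge0 : forall k, 0 <= p k) (p_sum : \sum_k p k = 1).
Hypothesis gap : lam m < lam ord0.
Hypothesis lam_supp : forall k, p k != 0 -> lam m <= lam k.
Hypothesis lam_le : forall k, lam k <= lam ord0.

Let y k := (lam ord0 - lam k) / (lam ord0 - lam m).

Let t := \sum_k p k * y k.

Let gap0 : 0 < lam ord0 - lam m. Proof. by rewrite subr_gt0. Qed.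

Let y_ge0 k : 0 <= y k.
Proof. by rewrite divr_ge0// ?(ltW gap0)// subr_ge0. Qed.

Let y_le1 k : p k != 0 -> y k <= 1.
Proof. by move=> pk; rewrite ler_pdivrMr// mul1r lerD2l lerN2 lam_supp. Qed.

Let py_le k : p k * y k <= p k.
Proof.
have [->|pk] := eqVneq (p k) 0; first by rewrite mul0r.
by rewrite ler_piMr// y_le1.
Qed.

Let y0 : y ord0 = 0. Proof. by rewrite /y subrr mul0r. Qed.

Lemma mean_bounds : 0 <= t <= 1 - p ord0.
Proof.
rewrite sumr_ge0/= => [|k _]; last by rewrite mulr_ge0.
rewrite -p_sum /t [in leLHS](bigD1 ord0)//= [in leRHS](bigD1 ord0)//= y0.
by rewrite mulr0 add0r addrC addrK ler_sum.
Qed.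

(** The variance of [lam] is the squared gap times that of [y]. On the support of [p], [y] lies in
    [0, 1], so y^2 <= y and the second moment of [y] is at most [t]. *)
Lemma variance_bound :
  \sum_k p k * lam k ^+ 2 - (\sum_k p k * lam k) ^+ 2
    <= (lam ord0 - lam m) ^+ 2 * (t * (1 - t)).
Proof.
set g := lam ord0 - lam m.
have lamE k : lam k = lam ord0 - g * y k.
  by rewrite mulrC divfK ?gt_eqF// opprB addrC subrK.
have sum_const a : a = \sum_k p k * a by rewrite -mulr_suml p_sum mul1r.
have -> : \sum_k p k * lam k = lam ord0 - g * t.
  rewrite mulr_sumr [X in X - _]sum_const -sumrB.
  by apply: eq_bigr => k _; rewrite {1}(lamE k); ring.
have -> : \sum_k p k * lam k ^+ 2
    = lam ord0 ^+ 2 - 2 * lam ord0 * g * t + g ^+ 2 * \sum_k p k * y k ^+ 2.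
  rewrite !mulr_sumr [X in X - _]sum_const -sumrB -big_split.
  by apply: eq_bigr => k _; rewrite /= {1}(lamE k); ring.
have : \sum_k p k * y k ^+ 2 <= t.
  apply: ler_sum => k _; rewrite expr2 mulrA.
  have [->|pk] := eqVneq (p k) 0; first by rewrite !mul0r.
  by rewrite ler_piMr ?y_le1// mulr_ge0.
rewrite -(ler_pM2l (exprn_gt0 2 gap0)) -/g.
by set a := \sum_k _; nra.
Qed.

(** Equality makes the nonnegative terms p_j (1 - y_j), for j other than [ord0], sum to zero. Each
    vanishes, so y_k = 1 wherever p_k is nonzero. *)
Lemma mean_extremal k : t = 1 - p ord0 -> k != ord0 -> p k != 0 -> lam k = lam m.
Proof.
move=> tE k0 pk.
have /eqP : \sum_(j | j != ord0) (p j - p j * y j) = 0.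
  rewrite sumrB; apply/eqP; rewrite subr_eq0; apply/eqP.
  move: tE; rewrite -p_sum /t [in LHS](bigD1 ord0)//= [in X in _ = X - _](bigD1 ord0)//= y0.
  by rewrite mulr0 add0r addrC addrK.
rewrite psumr_eq0 => [/allP/(_ k)|j _]; last by rewrite subr_ge0.
rewrite mem_index_enum k0 /= => /(_ isT).
rewrite -{1}[p k]mulr1 -mulrBr mulf_eq0 (negbTE pk) /= subr_eq0 => /eqP y1.
have : lam ord0 - lam k = lam ord0 - lam m.
  by rewrite -[LHS](divfK (lt0r_neq0 gap0)) -[_ / _]/(y k) -y1 mul1r.
by move/addrI/oppr_inj.
Qed.

End Variance.

(** [Num.sqrt] is 0 at negative arguments, so a variance can be bounded before its sign is known. *)
Lemma sqr_sqrt_le (R : rcfType) (x y : R) : 0 <= y -> x <= y -> Num.sqrt x ^+ 2 <= y.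
Proof.
move=> y0; case: (lerP 0 x) => [x0|x0 _]; first by rewrite sqr_sqrtr.
by rewrite ler0_sqrtr ?(ltW x0)// expr0n.
Qed.

(** * The lower bound on the mismatch and its equality case *)

Section Bound.
Variables (R : realType) (n : nat) (psi : 'cV[R[i]]_n.+1).
Hypothesis psi1 : braket psi psi = 1.
Implicit Types (rho : 'M[R[i]]_n.+1) (lam : 'I_n.+1 -> R)
  (v : 'I_n.+1 -> 'cV[R[i]]_n.+1) (m : 'I_n.+1).

Lemma infidelityE v : infidelity psi (v ord0) = 1 - weight v psi ord0.
Proof. by rewrite /infidelity /weight braketC norm_conjC. Qed.

Lemma Delta_mE rho lam m : lam ord0 != 0 ->
  Delta_m rho psi lam m = std_dev rho psi / (lam ord0 - lam m).
Proof.
move=> l0; have -> : lam ord0 - lam m = lam ord0 * (1 - lam m / lam ord0) by field.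
by rewrite /Delta_m invfM mulrA.
Qed.

(** An eigenvector of eigenvalue 0 lies in the kernel and so carries no weight; every eigenvalue
    with weight is therefore nonzero. *)
Lemma support_bounds rho lam v m k :
  eigensystem rho lam v -> smallest_nonzero lam m -> no_kernel_overlap rho psi ->
  weight v psi k != 0 -> lam m <= lam k.
Proof.
move=> [von rhov _ _ _] [_ minm] ker; rewrite weight_eq0 => bk.
apply: minm; apply: contra_neq bk => lk0.
by apply: ker; rewrite rhov lk0 scale0r.
Qed.

(** Applies the variance estimates to the Born weights, with [t] the mean of the rescaled spectrum;
    the last clause prepares the equality case. *)
Lemma sqr_Delta_m_le rho lam v m :
  eigensystem rho lam v -> smallest_nonzero lam m -> no_kernel_overlap rho psi ->
  lam m < lam ord0 ->
  exists t, [/\ 0 <= t <= 1 - weight v psi ord0,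
     Delta_m rho psi lam m ^+ 2 <= t * (1 - t)
   & t = 1 - weight v psi ord0 ->
     forall k, k != ord0 -> lam k != lam m -> braket (v k) psi = 0].
Proof.
move=> es minm ker gap; have [von rhov _ decr lam0] := es.
have supp k := support_bounds (k := k) es minm ker.
have top k : lam k <= lam ord0 by exact: decr.
have l0 : lam ord0 != 0 by rewrite gt_eqF// (le_lt_trans (lam0 m)).
have g0 : 0 < lam ord0 - lam m by rewrite subr_gt0.
have w0 := weight_ge0 v psi; have w1 := sum_weight von psi1.
exists (\sum_k weight v psi k * ((lam ord0 - lam k) / (lam ord0 - lam m))).
have tb := mean_bounds w0 w1 gap supp top.
split=> [//||tE k k0].
  have := variance_bound w0 w1 gap supp top.
  rewrite (Delta_mE _ _ l0) expr_div_n ler_pdivrMr ?exprn_gt0// [leRHS]mulrC.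
  move: tb; set t := \sum_k _ => /andP[t0 tp] Vt.
  rewrite (eigen_var von _ rhov); apply: sqr_sqrt_le Vt.
  rewrite mulr_ge0 ?sqr_ge0// mulr_ge0// subr_ge0.
  by rewrite (le_trans tp)// gerBl.
move=> lkm; apply/eqP; rewrite -weight_eq0; apply: contraNT lkm => wk.
exact/eqP/(mean_extremal w0 w1 gap supp tE k0 wk).
Qed.

(** The part [q] of [psi] orthogonal to [v ord0] lies in the [lam m]-eigenspace. The reflection
    carrying [q] to a multiple of [v m] acts inside that eigenspace, so the reflected basis is still
    an eigenbasis. *)
Lemma rotate_eigensystem rho lam v m : m != ord0 -> eigensystem rho lam v ->
  (forall k, k != ord0 -> lam k != lam m -> braket (v k) psi = 0) ->
  exists w, [/\ eigensystem rho lam w,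
    forall k, lam k != lam m -> w k = v k
  & forall k, k != ord0 -> k != m -> braket (w k) psi = 0].
Proof.
move=> m0 [von rhov dom decr lam0] orth.
pose q := psi - braket (v ord0) psi *: v ord0.
have vv k : braket (v k) (v k) = 1 by rewrite von eqxx.
have vq k : lam k != lam m -> braket (v k) q = 0.
  move=> lk; rewrite braketBr braketZr von; have [->|k0] := eqVneq k ord0.
    by rewrite mulr1 subrr.
  by rewrite mulr0 subr0 orth.
have rhoq : rho *m q = (lam m)%:C *: q.
  rewrite (basis_expand von q) mulmx_sumr scaler_sumr; apply: eq_bigr => k _.
  have [lk|lk] := eqVneq (lam k) (lam m); last by rewrite vq// scale0r mulmx0 scaler0.
  by rewrite -scalemxAr rhov lk !scalerA mulrC.
have [a aq] := reflection_to_axis q (vv m); set u := _ - q in aq.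
have rhou : rho *m u = (lam m)%:C *: u.
  by rewrite /u mulmxBr -scalemxAr rhov rhoq [RHS]scalerBr !scalerA [a * _]mulrC.
(* Such a [v k] is orthogonal to both [v m] and [q], hence to [u]. *)
have uv k : lam k != lam m -> reflection u (v k) = v k.
  move=> lk; apply: reflection_fix.
  rewrite braketBl braketZl von (braketC (v k) q) vq// conjC0 subr0.
  by case: (m =P k) lk => [->|_ _]; rewrite ?eqxx ?mulr0.
have v0 : reflection u (v ord0) = v ord0 by rewrite uv// gt_eqF// dom.
have won := reflection_onb u von.
exists (reflection u \o v); split=> [|k lk|k k0 km] /=; last 2 first.
- exact: uv.
- have -> : psi = q + braket (v ord0) psi *: v ord0 by rewrite subrK.
  (* Moving the reflection to the right factor turns [q] into [a *: v m], orthogonal to [v k] as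
     [k != m]. *)
  rewrite braketDr braketZr !reflection_self_adjoint aq v0 braketZr !von.
  by rewrite (negbTE k0) (negbTE km) !mulr0 addr0.
split=> // k /=; have [lk|lk] := eqVneq (lam k) (lam m); last by rewrite uv.
by rewrite /reflection mulmxBr -scalemxAr rhou rhov lk [RHS]scalerBr !scalerA [_ * (lam m)%:C]mulrC.
Qed.

Lemma mismatch_bound0 : mismatch_bound (0 : R) = 0.
Proof. by rewrite /mismatch_bound expr0n mulr0 subr0 sqrtr1 subrr mul0r. Qed.

Lemma weight1_orth v k : orthonormal_basis v ->
  weight v psi ord0 = 1 -> k != ord0 -> braket (v k) psi = 0.
Proof.
move=> von w1 k0; apply/eqP; rewrite -weight_eq0.
have := sum_weight von psi1; rewrite (bigD1 ord0)//= w1 -[RHS]addr0 => /addrI/eqP.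
rewrite psumr_eq0 => [/allP/(_ k)|j _]; last exact: weight_ge0.
by rewrite mem_index_enum k0 => /(_ isT).
Qed.

Lemma weight_le1 v k : orthonormal_basis v -> weight v psi k <= 1.
Proof.
move=> von; rewrite -(sum_weight von psi1) (bigD1 k)//= lerDl sumr_ge0// => j _.
exact: weight_ge0.
Qed.

Lemma mismatch_lower_bound rho lam v m :
  eigensystem rho lam v -> smallest_nonzero lam m -> no_kernel_overlap rho psi ->
  let Delta := Delta_m rho psi lam m in
  let c := infidelity psi (v ord0) in
  [/\ 4 * Delta ^+ 2 <= 1,
      mismatch_bound Delta <= c
    & c = mismatch_bound Delta ->
      braket (v ord0) psi != 0 /\
      exists w : 'I_n.+1 -> 'cV[R[i]]_n.+1,
        [/\ eigensystem rho lam w,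
            forall k, lam k != lam m -> w k = v k,
            0 < Delta -> braket (w m) psi != 0
          & forall k, k != ord0 -> k != m -> braket (w k) psi = 0]].
Proof.
move=> es minm ker Delta c; have [von _ dom decr lam0] := es.
(* The bound never exceeds 1/2, so equality leaves weight at least 1/2 on [v ord0]. *)
have bv0 : c = mismatch_bound Delta -> braket (v ord0) psi != 0.
  have := mismatch_bound_le_half Delta.
  rewrite /c infidelityE -weight_eq0 => b2 cb; rewrite gt_eqF//; lra.
(* Pure case: the totalized division makes [Delta] zero, the bound reads 0 <= c, and equality puts
   all weight on [v ord0]. *)
have [m0|m0] := eqVneq m ord0.
  have D0 : Delta = 0.
    rewrite /Delta /Delta_m m0 divff ?subrr ?invr0 ?mulr0//.
    by case: minm; rewrite m0.
  split; first by rewrite D0 expr0n mulr0.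
    by rewrite D0 mismatch_bound0 /c infidelityE subr_ge0 weight_le1.
  move=> cb; split; first exact: bv0.
  exists v; split=> //; first by rewrite D0 ltxx.
  move=> k k0 _; apply: weight1_orth => //; apply/esym/eqP; rewrite -subr_eq0.
  by rewrite -infidelityE -/c cb D0 mismatch_bound0.
have [t [tb Dt text]] := sqr_Delta_m_le es minm ker (dom _ m0).
rewrite -infidelityE -/c in tb text.
split=> [||cb]; first exact: four_sqr_le1 Dt; first exact: mismatch_bound_le tb Dt.
split; first exact: bv0.
have /text orth : t = c by rewrite cb; apply: mismatch_bound_eq; rewrite -?cb.
have [w [ws wv worth]] := rotate_eigensystem m0 es orth.
(* If [w m] were orthogonal to [psi] too, all weight would sit on [w ord0 = v ord0]; then c = 0, and
   the root equation forces [Delta = 0]. *)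
exists w; split=> // D0; apply/eqP => wm0; move: D0.
have wE : weight w psi ord0 = 1.
  have [won _ _ _ _] := ws; rewrite -(sum_weight won psi1) (bigD1 ord0)//= big1 ?addr0//.
  move=> k k0; apply/eqP; rewrite weight_eq0; have [->|km] := eqVneq k m; first exact/eqP.
  by rewrite worth.
have c0 : c = 0.
  by rewrite /c -(wv ord0) ?infidelityE ?wE ?subrr// gt_eqF// dom.
have := mismatch_boundM (four_sqr_le1 Dt); rewrite -/Delta -cb c0 mul0r.
by move/esym/eqP; rewrite sqrf_eq0 => /eqP ->; rewrite ltxx.
Qed.

End Bound.

(** * States with prescribed eigenbasis and spectrum *)

Lemma adjmxZ (C : numClosedFieldType) (p q : nat) (a : C) (A : 'M[C]_(p, q)) :
  (a *: A)^t* = a^*%R *: A^t*.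
Proof. by apply/matrixP => i j; rewrite !mxE rmorphM. Qed.

Section SpectralState.
Variables (R : realType) (d : nat) (v : 'I_d -> 'cV[R[i]]_d) (lam : 'I_d -> R).
Hypothesis von : orthonormal_basis v.

Definition spectral_state : 'M[R[i]]_d := \sum_k (lam k)%:C *: (v k *m (v k)^t*).

Lemma spectral_state_mul x :
  spectral_state *m x = \sum_k ((lam k)%:C * braket (v k) x) *: v k.
Proof.
rewrite mulmx_suml; apply: eq_bigr => k _.
by rewrite -scalemxAl -mulmxA [(v k)^t* *m x]mx11_scalar mul_mx_scalar scalerA.
Qed.

Lemma spectral_state_eigen k : spectral_state *m v k = (lam k)%:C *: v k.
Proof.
rewrite spectral_state_mul (bigD1 k)//= big1 ?addr0 => [|j jk].
  by rewrite von eqxx mulr1.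
by rewrite von (negbTE jk) mulr0 scale0r.
Qed.

Lemma spectral_state_herm : spectral_state \is hermsymmx.
Proof.
apply/is_hermitianmxP; rewrite expr0 scale1r /spectral_state.
rewrite raddf_sum map_mx_sum; apply: eq_bigr => k _.
rewrite [RHS](adjmxZ (lam k)%:C) trmx_mul map_mxM trmxCK; congr (_ *: _).
exact/esym/conjc_real.
Qed.

Lemma spectral_state_trace : \tr spectral_state = (\sum_k lam k)%:C.
Proof.
rewrite raddf_sum rmorph_sum; apply: eq_bigr => k _.
rewrite [LHS]mxtraceZ mxtrace_mulC trace_mx11 -[X in _ * X]/(braket (v k) (v k)).
by rewrite von eqxx mulr1.
Qed.

Lemma spectral_state_density : (forall k, 0 <= lam k) -> \sum_k lam k = 1 ->
  density spectral_state.
Proof.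
move=> lam0 lam1; split; first exact: spectral_state_herm.
  move=> u; rewrite spectral_state_mul braket_sumr sumr_ge0// => k _.
  rewrite braketZr (braketC (v k) u) -mulrA -normCK mulr_ge0 ?exprn_ge0//.
  by rewrite lecR.
by rewrite spectral_state_trace lam1.
Qed.

End SpectralState.

(** * Bases adapted to the ideal state *)

Lemma std_basis_onb (R : realType) d :
  orthonormal_basis (fun k : 'I_d => delta_mx k 0 : 'cV[R[i]]_d).
Proof.
move=> j k; rewrite /braket mxE (bigD1 j)//= big1 => [|l lj].
  by rewrite !mxE !eqxx conjC1 mul1r addr0 andbT.
by rewrite !mxE (negbTE lj) /= conjC0 mul0r.
Qed.

(** Reflect the standard basis by the reflection that sends [psi] to the first axis;
    self-adjointness transfers the orthogonality. *)
Lemma adapted_basis (R : realType) n (psi : 'cV[R[i]]_n.+1) :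
  exists2 f : 'I_n.+1 -> 'cV[R[i]]_n.+1, orthonormal_basis f &
    forall k, k != ord0 -> braket (f k) psi = 0.
Proof.
have e := @std_basis_onb R n.+1.
have e0 : braket (delta_mx ord0 0) (delta_mx ord0 0 : 'cV[R[i]]_n.+1) = 1.
  by rewrite e eqxx.
have [a aq] := reflection_to_axis psi e0.
exists (reflection (a *: delta_mx ord0 0 - psi) \o (fun k => delta_mx k 0)).
  exact: reflection_onb.
move=> k k0 /=; rewrite reflection_self_adjoint aq braketZr e (negbTE k0).
by rewrite mulr0.
Qed.

Section Rotation.
Variables (R : realType) (d : nat) (f : 'I_d -> 'cV[R[i]]_d) (i0 i1 : 'I_d).
Variables (x y : R).
Hypotheses (fon : orthonormal_basis f) (i10 : i1 != i0) (xy : x ^+ 2 + y ^+ 2 = 1).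

(** The matrix with rows (x, y) and (y, -x) is orthogonal with determinant -1; it differs from a
    rotation only by the sign of the second vector. *)
Definition plane_rotation k :=
  if k == i0 then x%:C *: f i0 + y%:C *: f i1
  else if k == i1 then y%:C *: f i0 - x%:C *: f i1 else f k.

Lemma plane_rotation_onb : orthonormal_basis plane_rotation.
Proof.
have xyC : x%:C * x%:C + y%:C * y%:C = 1 :> R[i].
  by rewrite -!rmorphM -rmorphD -!expr2 /= xy.
have cR (z : R) : (z%:C)^*%R = z%:C by exact: conjc_real.
have i01 : (i0 == i1) = false by rewrite eq_sym (negbTE i10).
move=> j k; rewrite /plane_rotation.
case: (eqVneq j i0) => [->|j0]; [|case: (eqVneq j i1) => [->|j1]];
  (case: (eqVneq k i0) => [kE|k0]; [|case: (eqVneq k i1) => [kE|k1]]);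
  rewrite ?kE;
  rewrite ?(braketBl, braketBr, braketDl, braketDr, braketZl, braketZr) ?cR !fon
    ?eqxx ?i01 ?(negbTE i10) ?(negbTE j0) ?(negbTE j1) ?(negbTE k0) ?(negbTE k1);
  rewrite ?[i0 == k]eq_sym ?[i1 == k]eq_sym ?(negbTE k0) ?(negbTE k1);
  rewrite ?mulr0 ?mulr1 ?subrr ?addr0 ?add0r ?subr0 ?sub0r ?mulrN ?opprK //.
- by rewrite mulrC subrr.
- by rewrite mulrC subrr.
- by rewrite addrC xyC.
Qed.
End Rotation.

(** * Saturating states of rank two *)

Section BestCase.
Variables (R : realType) (n : nat) (psi : 'cV[R[i]]_n.+1).
Hypothesis psi1 : braket psi psi = 1.
Variables (f : 'I_n.+1 -> 'cV[R[i]]_n.+1) (i1 : 'I_n.+1) (D : R).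
Hypotheses (fon : orthonormal_basis f) (i1E : i1 = 1%N :> nat).
Hypothesis forth : forall k, k != ord0 -> braket (f k) psi = 0.
Hypothesis D_range : 0 <= D <= 1 / 2.

Let b := mismatch_bound D.

(** Placing [1 - a] at index 1 keeps the eigenvalues in nonincreasing order when 1/2 < a < 1. *)
Definition best_spectrum (a : R) (k : 'I_n.+1) : R :=
  if k == ord0 then a else if k == i1 then 1 - a else 0.

(** As [psi] is parallel to [f ord0], these amplitudes give it weights [1 - b] and [b], so the
    infidelity is [b] whatever the spectrum. *)
Definition best_basis : 'I_n.+1 -> 'cV[R[i]]_n.+1 :=
  plane_rotation f ord0 i1 (Num.sqrt (1 - b)) (Num.sqrt b).

Definition best_state (a : R) := spectral_state best_basis (best_spectrum a).

Let i10 : i1 != ord0.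
Proof. by apply/eqP => /(congr1 (@nat_of_ord _)); rewrite i1E. Qed.

Let b0 : 0 <= b. Proof. exact: mismatch_bound_ge0. Qed.
Let b1 : 0 <= 1 - b.
Proof. by have := mismatch_bound_le_half D; rewrite -/b; lra. Qed.

Let bM : b * (1 - b) = D ^+ 2.
Proof. by apply: mismatch_boundM; case/andP: D_range => ? ?; nra. Qed.

Lemma best_basis_onb : orthonormal_basis best_basis.
Proof. by apply: plane_rotation_onb => //; rewrite !sqr_sqrtr// subrK. Qed.

Let f0_weight : `|braket (f ord0) psi| ^+ 2 = 1.
Proof.
have := parseval fon psi psi; rewrite psi1 (bigD1 ord0)//= big1 => [|k k0].
  by rewrite addr0 [braket psi _]braketC -normCKC => ->.
by rewrite forth// mulr0.
Qed.

Let cR (z : R) : (z%:C)^*%R = z%:C. Proof. exact: conjc_real. Qed.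

Let weight_scale (z : R) : 0 <= z -> forall x : R[i],
  x = (Num.sqrt z)%:C * braket (f ord0) psi -> `|x| ^+ 2 = z%:C.
Proof.
move=> z0 x ->; rewrite normrM exprMn f0_weight mulr1 normCK cR -rmorphM -expr2.
by rewrite sqr_sqrtr.
Qed.

Lemma best_weight k :
  weight best_basis psi k = if k == ord0 then 1 - b else if k == i1 then b else 0.
Proof.
apply: (@complexI R); rewrite weightE /best_basis /plane_rotation.
have [k0|k0] := eqVneq k ord0; [|have [k1|k1] := eqVneq k i1].
- apply: weight_scale => //; rewrite braketDl !braketZl !cR.
  by rewrite (forth i10) mulr0 addr0.
- apply: weight_scale => //; rewrite braketBl !braketZl !cR.
  by rewrite (forth i10) mulr0 subr0.
- by rewrite forth// normr0 expr0n.
Qed.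

Lemma sum_plane (F : 'I_n.+1 -> R) :
  (forall k, k != ord0 -> k != i1 -> F k = 0) -> \sum_k F k = F ord0 + F i1.
Proof.
move=> F0; rewrite (bigD1 ord0)//= (bigD1 i1)//= big1 ?addr0// => k /andP[k0 k1].
exact: F0.
Qed.

Variable a : R.
Hypothesis a_range : 1 / 2 < a < 1.

Let lam0E : best_spectrum a ord0 = a. Proof. by rewrite /best_spectrum eqxx. Qed.
Let lam1E : best_spectrum a i1 = 1 - a.
Proof. by rewrite /best_spectrum (negbTE i10) eqxx. Qed.
Let lamE k : k != ord0 -> k != i1 -> best_spectrum a k = 0.
Proof. by rewrite /best_spectrum => /negbTE -> /negbTE ->. Qed.

Lemma best_spectrum_ge0 k : 0 <= best_spectrum a k.
Proof.
have /andP[a_half a_lt1] := a_range.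
by rewrite /best_spectrum; case: ifP => _; [|case: ifP => _]; lra.
Qed.

Lemma best_density : density (best_state a).
Proof.
apply: spectral_state_density best_basis_onb best_spectrum_ge0 _.
by rewrite sum_plane ?lam0E ?lam1E ?subrKC//; lra.
Qed.

Lemma best_eigensystem : eigensystem (best_state a) (best_spectrum a) best_basis.
Proof.
have /andP[a_half a_lt1] := a_range.
split=> [|||j k jk|]; first exact: best_basis_onb.
- exact: spectral_state_eigen best_basis_onb.
- by move=> k k0; rewrite lam0E /best_spectrum (negbTE k0); case: ifP => _; lra.
- rewrite /best_spectrum -!(inj_eq val_inj) /= i1E.
  by case: (nat_of_ord j) (nat_of_ord k) jk => [|[|j']] [|[|k']]//= _; lra.
- exact: best_spectrum_ge0.
Qed.

Lemma best_smallest_nonzero : smallest_nonzero (best_spectrum a) i1.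
Proof.
have /andP[a_half a_lt1] := a_range.
split=> [|k]; first by rewrite lam1E gt_eqF// subr_gt0.
rewrite lam1E /best_spectrum; case: ifP => _; first lra.
by case: ifP => _; rewrite ?eqxx.
Qed.

(** In the Parseval sum for [u] and [psi], a nonzero eigenvalue kills the component of [u], and a
    zero eigenvalue comes with zero weight of [psi]. *)
Lemma best_no_kernel_overlap : no_kernel_overlap (best_state a) psi.
Proof.
have /andP[a_half a_lt1] := a_range.
move=> u ru; rewrite (parseval best_basis_onb) big1// => k _.
have [_ rhov _ _ _] := best_eigensystem; have [rhoH _ _] := best_density.
have /eqP := eigen_adj rhov k u rhoH; rewrite ru braket0r eq_sym mulf_eq0.
case/orP => [lk|/eqP bu]; last by rewrite braketC bu conjC0 mul0r.
have : weight best_basis psi k == 0.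
  rewrite best_weight; move: lk; rewrite -(inj_eq (@complexI R)) /best_spectrum.
  rewrite !(inj_eq (@complexI R)); case: ifP => _ => [/eqP|]; first lra.
  by case: ifP => _ => [/eqP|//]; lra.
by rewrite weight_eq0 => /eqP ->; rewrite mulr0.
Qed.

Lemma best_gap : best_spectrum a i1 < best_spectrum a ord0.
Proof.
have /andP[a_half a_lt1] := a_range.
by rewrite lam0E lam1E; lra.
Qed.

Lemma best_Delta : Delta_m (best_state a) psi (best_spectrum a) i1 = D.
Proof.
have /andP[a_half a_lt1] := a_range.
rewrite Delta_mE ?lam0E ?lam1E ?gt_eqF//; last lra.
have [_ rhov _ _ _] := best_eigensystem.
rewrite (eigen_var best_basis_onb _ rhov) !sum_plane; last 2 first.
- by move=> k k0 k1; rewrite lamE// mulr0.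
- by move=> k k0 k1; rewrite lamE// expr0n mulr0.
rewrite !best_weight eqxx (negbTE i10) eqxx lam0E lam1E.
(* A two-point distribution with weights 1 - b and b has variance b (1 - b) times the squared gap,
   and b (1 - b) = D^2. *)
rewrite (_ : _ - _ = (D * (a - (1 - a))) ^+ 2); last by rewrite exprMn -bM; ring.
rewrite sqrtr_sqr ger0_norm ?mulfK// ?gt_eqF//; first lra.
by case/andP: D_range => D0 _; rewrite mulr_ge0//; lra.
Qed.

Lemma best_infidelity : infidelity psi (best_basis ord0) = mismatch_bound D.
Proof. by rewrite infidelityE best_weight eqxx subKr. Qed.

End BestCase.

(** The basis does not depend on [a], which is recovered as the expectation of the state in its
    first vector. *)
Lemma best_state_inj (R : realType) n (f : 'I_n.+1 -> 'cV[R[i]]_n.+1) (i1 : 'I_n.+1) D :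
  orthonormal_basis f -> i1 = 1%N :> nat -> injective (best_state f i1 D).
Proof.
move=> fon i1E a a' aa'.
have von : orthonormal_basis (best_basis f i1 D) by exact: best_basis_onb.
have eigen x : braket (best_basis f i1 D ord0)
    (best_state f i1 D x *m best_basis f i1 D ord0) = x%:C.
  rewrite (spectral_state_eigen _ von) braketZr von eqxx mulr1.
  by rewrite /best_spectrum eqxx.
by apply: (@complexI R); rewrite -!eigen aa'.
Qed.

Unset Implicit Arguments.

Theorem lemma1 (R : realType) (n : nat) (psi_id : 'cV[R[i]]_n.+1)
    (psi_id_unit : braket psi_id psi_id = 1) :
  (forall (rho : 'M[R[i]]_n.+1) (lam : 'I_n.+1 -> R)
          (v : 'I_n.+1 -> 'cV[R[i]]_n.+1) (m : 'I_n.+1),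
     density rho -> eigensystem rho lam v -> smallest_nonzero lam m ->
     no_kernel_overlap rho psi_id ->
     let Delta := Delta_m rho psi_id lam m in
     let c := infidelity psi_id (v ord0) in
     [/\ 4 * Delta ^+ 2 <= 1,
         mismatch_bound Delta <= c
       & c = mismatch_bound Delta ->
         braket (v ord0) psi_id != 0 /\
         exists w : 'I_n.+1 -> 'cV[R[i]]_n.+1,
           [/\ eigensystem rho lam w,
               forall k, lam k != lam m -> w k = v k,
               0 < Delta -> braket (w m) psi_id != 0
             & forall k, k != ord0 -> k != m -> braket (w k) psi_id = 0]])
  /\
  @mismatch_bound R =
    (fun x : R => x ^+ 2 + x ^+ 4) +O_ (0 : R) (fun x : R => x ^+ 6)
  /\
  ((0 < n)%N -> forall D : R, 0 <= D <= 1 / 2 ->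
     infinite_set [set rho : 'M[R[i]]_n.+1 |
       exists (lam : 'I_n.+1 -> R) (v : 'I_n.+1 -> 'cV[R[i]]_n.+1)
              (m : 'I_n.+1),
         [/\ density rho, eigensystem rho lam v, smallest_nonzero lam m,
             no_kernel_overlap rho psi_id
           & [/\ lam m < lam ord0,
                 Delta_m rho psi_id lam m = D
               & infidelity psi_id (v ord0) = mismatch_bound D]]]).
Proof.
split=> [rho lam v m _|]; first exact: mismatch_lower_bound.
split=> [|n0 D D_range]; first exact: mismatch_bound_expansion.
have [f fon forth] := adapted_basis psi_id.
pose i1 : 'I_n.+1 := Ordinal (n0 : (1 < n.+1)%N).
(* Distinct values in [2/3, 1); a shift by 2 would start at 1/2, where the top eigenvalue is
   degenerate. *)
pose a (j : nat) : R := 1 - j.+3%:R^-1.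
have a_range j : 1 / 2 < a j < 1.
  rewrite /a gtrBl invr_gt0 ltr0n andbT.
  have : (j.+3%:R : R)^-1 <= 3^-1 by rewrite lef_pV2 ?posrE ?ler_nat ?ltr0n.
  by move: (j.+3%:R^-1) => x; lra.
have a_inj : injective a.
  by move=> j k /addrI/oppr_inj/invr_inj/eqP; rewrite eqr_nat => /eqP[].
have i1E : i1 = 1%N :> nat by [].
(* Were the set finite, so would be its preimage under the injection sending [j] to the state with
   parameter [a j]; that preimage is all of [nat]. *)
apply/contra_not: infinite_nat => fin.
set B := (X in finite_set X) in fin.
suff <- : (best_state f i1 D \o a) @^-1` B = [set: nat].
  apply: finite_preimage fin => j k _ _ /=.
  by move=> /(best_state_inj fon i1E)/a_inj.
apply/seteqP; split=> // j _ /=.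
exists (best_spectrum i1 (a j)), (best_basis f i1 D), i1; split.
- exact: best_density.
- exact: best_eigensystem.
- exact: best_smallest_nonzero.
- exact: best_no_kernel_overlap.
- split; [exact: best_gap|exact: best_Delta|exact: best_infidelity].
Qed.
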